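(* The following are equivalent for a Polish group $G$. (1) $G$ is Roelcke precompact. (2) For every $n\geqslant 1$ and open $V\ni 1$ there is a finite set $F\subseteq G$ such that $$\underbrace{G\times \ldots\times G}_{n\text{ times}}=V\cdot (\underbrace{FV\times \ldots \times FV}_{n \text{ times}}).$$ (3) For any continuous isometric action $\alpha\colon G\curvearrowright X$ on a metric space $(X,d)$ inducing a dense orbit, any open $U\ni 1$, $\epsilon>0$ and $n\geqslant 1$, there is a finite set $A\subseteq X^n$ such that $U\cdot A$ is $\epsilon$-dense in $(X^n,d_\infty)$. (4) $G$ is topologically isomorphic to a closed subgroup $H\leqslant \mathrm{Isom}(X,d)$, where $(X,d)$ is a separable complete metric space, $\mathrm{Isom}(X,d)$ is equipped with the topology of pointwise convergence and the action of $H$ on $X$ is approximately oligomorphic and induces a dense orbit.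
   Context: A Polish group is a separable, completely metrisable topological group. A topological group $G$ is Roelcke precompact if for any open $V\ni 1$ there is a finite set $F\subseteq G$ such that $G=VFV$. In (2), $V$ acts diagonally by left multiplication on $G^n$, i.e., $V\cdot(FV\times\ldots\times FV)=\{(vx_1,\ldots,vx_n) : v\in V,\ x_i\in FV\}$. If $G$ acts by isometries on a metric space $(X,d)$, then for $n\geqslant 1$, $G$ acts diagonally on $X^n$ by $g\cdot(x_1,\ldots,x_n)=(gx_1,\ldots,gx_n)$, and $X^n$ is equipped with the supremum metric $d_\infty\big((x_1,\ldots,x_n),(y_1,\ldots,y_n)\big)=\sup_{1\leqslant i\leqslant n}d(x_i,y_i)$. For $U\subseteq G$ and $A\subseteq X^n$, $U\cdot A=\{g\cdot\overline x : g\in U,\ \overline x\in A\}$. An isometric action of a group $G$ on $(X,d)$ is approximately oligomorphic if for any $n\geqslant 1$ and $\epsilon>0$ there is a finite set $A\subseteq X^n$ such that $G\cdot A$ is $\epsilon$-dense in $(X^n,d_\infty)$. An action is continuous if $G\times X\to X$ is jointly continuous. $\mathrm{Isom}(X,d)$ is the group of surjective isometries of $X$. *)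

(* Defs.v *)
From HB Require Import structures.
From mathcomp Require Import all_boot all_order all_algebra.
From mathcomp Require Import all_classical all_reals all_analysis.

Set Implicit Arguments.
Unset Strict Implicit.
Unset Printing Implicit Defensive.

Import Order.TTheory GRing.Theory Num.Theory.

Local Open Scope classical_set_scope.
Local Open Scope ring_scope.

HB.mixin Record Topological_isTopologicalGroup G & Group G & Topological G := {
  mulg_continuous : continuous (fun p : G * G => (p.1 * p.2)%g) ;
  invg_continuous : continuous (fun x : G => x^-1%g)
}.

#[short(type="topologicalGroupType")]
HB.structure Definition TopologicalGroup :=
  { G of Group G & Topological G & Topological_isTopologicalGroup G }.

Definition homeomorphism (S T : topologicalType) (f : S -> T) : Prop :=
  continuous f /\
  exists g : T -> S, [/\ continuous g, cancel f g & cancel g f].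

Definition separable (T : topologicalType) : Prop :=
  exists2 D : set T, countable D & dense D.

(* The library's [completeType] is pointed, which a metric space need not be;
   the condition on filters is the same. *)
Definition complete_space (T : uniformType) : Prop :=
  forall F : set_system T, ProperFilter F -> cauchy F -> exists l : T, F --> l.

Definition completely_metrizable (R : realType) (T : topologicalType) : Prop :=
  exists (M : metricType R) (f : T -> M), complete_space M /\ homeomorphism f.

Definition polish_group (R : realType) (G : topologicalGroupType) : Prop :=
  separable G /\ completely_metrizable R G.

Definition mulset (G : groupType) (A B : set G) : set G :=
  [set (x * y)%g | x in A & y in B].

Definition roelcke_precompact (G : topologicalGroupType) : Prop :=
  forall V : set G, open V -> V 1%g ->
  exists2 F : set G, finite_set F & setT = mulset (mulset V F) V.

(* [S] is a bare type of acting elements: the acting group may be a subgroup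
   given as a subset type, and left multiplication is the case [X = S]. *)
Definition diag_translate (S X : Type) (act : S -> X -> X) (n : nat)
    (U : set S) (A : set ('I_n -> X)) : set ('I_n -> X) :=
  [set (fun i => act g (x i)) | g in U & x in A].

Definition dense_orbit (S : Type) (X : topologicalType)
    (act : S -> X -> X) : Prop :=
  exists x : X, dense [set act g x | g in setT].

(* The supremum metric: distances are nonnegative, so starting from 0 gives the
   maximum as soon as [n >= 1]. *)
Definition dist_sup (R : realType) (X : metricType R) (n : nat)
    (x y : 'I_n -> X) : R :=
  \big[Num.max/0]_(i < n) mdist (x i) (y i).

Definition sup_dense (R : realType) (X : metricType R) (n : nat) (eps : R)
    (A : set ('I_n -> X)) : Prop :=
  forall x : 'I_n -> X, exists2 a, A a & dist_sup x a < eps.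

Definition approx_oligomorphic (R : realType) (S : Type) (X : metricType R)
    (act : S -> X -> X) : Prop :=
  forall (n : nat) (eps : R), (1 <= n)%N -> 0 < eps ->
  exists2 A : set ('I_n -> X), finite_set A &
    sup_dense eps (diag_translate act setT A).

Definition isometry (R : realType) (X : metricType R) (f : X -> X) : Prop :=
  forall x y, mdist (f x) (f y) = mdist x y.

Definition group_action (G : groupType) (X : Type) (act : G -> X -> X) : Prop :=
  (forall x, act 1%g x = x) /\
  (forall g h x, act (g * h)%g x = act g (act h x)).

Definition continuous_isometric_action (R : realType) (G : topologicalGroupType)
    (X : metricType R) (act : G -> X -> X) : Prop :=
  [/\ group_action act,
      forall g, isometry (act g)
    & continuous (fun p : G * X => act p.1 p.2)].

Record isom (R : realType) (X : metricType R) := Isom {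
  isom_fun :> X -> X ;
  isom_isometry : isometry isom_fun ;
  isom_surj : forall y, exists x, isom_fun x = y
}.

Section isom_group.
Context {R : realType} {X : metricType R}.
Implicit Types f g h : isom X.

Lemma isomP f g : (forall x, f x = g x) -> f = g.
Proof.
case: f g => f fi fs [g gi gs] /= fg.
have {}fg : f = g by apply/funext.
by subst g; congr Isom; exact: Prop_irrelevance.
Qed.

Lemma isom_inj f : injective f.
Proof.
by move=> x y fxy; apply: mdist_positivity; rewrite -(isom_isometry f) fxy mdistxx.
Qed.

Definition isom_one : isom X :=
  @Isom R X id (fun _ _ => erefl) (fun y => ex_intro _ y erefl).

Program Definition isom_mul f g : isom X := @Isom R X (f \o g) _ _.
Next Obligation. by move=> f g x y /=; rewrite !isom_isometry. Qed.
Next Obligation.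
move=> f g z; have [y <-] := isom_surj f z; have [x <-] := isom_surj g y.
by exists x.
Qed.

Definition isom_inv_fun f (y : X) : X := sval (cid (isom_surj f y)).

Lemma isom_inv_funK f : cancel (isom_inv_fun f) f.
Proof. by move=> y; rewrite /isom_inv_fun; case: cid. Qed.

Program Definition isom_inv f : isom X := @Isom R X (isom_inv_fun f) _ _.
Next Obligation.
by move=> f x y; rewrite -(isom_isometry f) !isom_inv_funK.
Qed.
Next Obligation.
by move=> f x; exists (f x); apply: (@isom_inj f); rewrite isom_inv_funK.
Qed.

HB.instance Definition _ := gen_eqMixin (isom X).
HB.instance Definition _ := gen_choiceMixin (isom X).

Fact isom_mulA : associative isom_mul.
Proof. by move=> f g h; exact: isomP. Qed.
Fact isom_mul1 : left_id isom_one isom_mul.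
Proof. by move=> f; exact: isomP. Qed.
Fact isom_1mul : right_id isom_one isom_mul.
Proof. by move=> f; exact: isomP. Qed.
Fact isom_mulV : left_inverse isom_one isom_inv isom_mul.
Proof.
by move=> f; apply: isomP => x /=; apply: (@isom_inj f); rewrite isom_inv_funK.
Qed.
Fact isom_Vmul : right_inverse isom_one isom_inv isom_mul.
Proof. by move=> f; apply: isomP => x /=; rewrite isom_inv_funK. Qed.

HB.instance Definition _ :=
  isGroup.Build (isom X) isom_mulA isom_mul1 isom_1mul isom_mulV isom_Vmul.

HB.instance Definition _ := Topological.copy (isom X)
  (initial_topology (@isom_fun R X : isom X -> {ptws X -> X})).

End isom_group.

(* [H] carries the subspace topology, the one of the library's [set_type H]. *)
Definition topologically_isomorphic_to_subgroup (G : topologicalGroupType)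
    (R : realType) (X : metricType R) (H : set (isom X)) : Prop :=
  exists phi : G -> H, homeomorphism phi /\
    forall x y, set_val (phi (x * y)%g) = (set_val (phi x) * set_val (phi y))%g.

(* Main.v *)
Require Import Defs.
From HB Require Import structures.
From mathcomp Require Import all_boot all_order all_algebra.
From mathcomp Require Import all_classical all_reals all_analysis.
From mathcomp Require Import lra.

Set Implicit Arguments.
Unset Strict Implicit.
Unset Printing Implicit Defensive.

Import Order.TTheory GRing.Theory Num.Theory.

Local Open Scope classical_set_scope.
Local Open Scope ring_scope.

(** The cycle of implications rests on one observation in each direction.

    Powers are no harder to cover than the group.  If G^n = W.(FW)^n, then a
    further coordinate is brought under control by an element u of a
    neighbourhood of 1 so small that its conjugates by the finitely many f in
    F stay in W: such a u can be moved past f and absorbed in W, so that the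
    coordinates already treated are not spoilt ([roelcke_precompact_power]).
    Given a continuous isometric action and a point x0 with dense orbit, a
    covering G^n = V.(FV)^n says that every n-tuple is close to V.(f_1 x0,
    ..., f_n x0) for some f_1, ..., f_n in F, because V hardly moves x0
    ([power_cover_dense_translates]).

    For the converse, a basic neighbourhood of 1 in a group of isometries is
    given by a finite tuple x and a tolerance e, and v f w = g with v, w in
    this neighbourhood means that the pairs (x, g x) and (x, f x) have close
    translates.  Approximate oligomorphicity for the 2n-tuples (x, g x)
    leaves only finitely many such pairs up to translation
    ([approx_oligomorphic_roelcke_precompact]).

    What remains is to realise a Polish group G as a closed group of
    isometries with a dense orbit, so that the covering property of isometric
    actions can be applied to it.  A left invariant compatible metric d exists
    by the Birkhoff-Kakutani theorem ([birkhoff_kakutani]); G acts by left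
    translations on the completion X of (G, d), which is separable, and the
    orbit of 1 is dense.  The group topology is that of pointwise convergence
    on X ([translations_homeomorphic]).  The image of G is closed
    ([closed_translations]): being completely metrizable, G is a dense
    G_delta subset of X, so for an isometry h in the closure of G the sets G
    and h^-1(G) meet by the Baire category theorem, say h(a) = b with a and b
    in G, and then h is the translation by b a^-1. *)

(** * Finite sets, filters and metric spaces *)

Lemma finite_set_family (T : choiceType) (n : nat) (F : set T) :
  finite_set F -> finite_set [set x : 'I_n -> T | forall i, F (x i)].
Proof.
move=> /finite_seqP[s ->].
pose val_fun (f : {ffun 'I_n -> seq_sub s}) i := ssval (f i).
apply: (@sub_finite_set _ _ (val_fun @` setT)).
  move=> x /= xs; exists [ffun i => SeqSub (xs i)] => //.
  by apply/funext => i; rewrite /val_fun ffunE.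
exact/finite_image/finite_finset.
Qed.

Lemma filter_finite_set (T I : Type) (D : set I) (f : I -> set T)
    (F : set_system T) :
  Filter F -> finite_set D -> (forall i, D i -> F (f i)) ->
  F (\bigcap_(i in D) f i).
Proof.
move=> FF + Ff; have [->|/set0P[i0 Di0]] := eqVneq D set0.
  by move=> _; rewrite bigcap_set0; exact: filterT.
move=> /(@finite_fsetP {classic I})[s Ds]; rewrite Ds.
by apply: (@filter_bigI _ {classic I}) => i si; apply: Ff; rewrite Ds.
Qed.

Lemma mdist_le0_eq (R : realType) (X : metricType R) (x y : X) :
  mdist x y <= 0 -> x = y.
Proof.
by move=> xy; apply: mdist_positivity; apply/eqP; rewrite eq_le mdist_ge0 andbT.
Qed.

Lemma metric_nbhsP (R : realType) (X : metricType R) (x : X) (A : set X) :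
  nbhs x A <-> exists2 e : R, 0 < e & forall y, mdist x y < e -> A y.
Proof.
rewrite -metricType_numDomainType.filter_from_mdist_nbhs.
by split=> -[e e0 eA]; exists e.
Qed.

Lemma dense_metricP (R : realType) (X : metricType R) (D : set X) :
  dense D <-> forall x (e : R), 0 < e -> exists2 y, D y & mdist x y < e.
Proof.
split=> [dD x e e0|dD O [x Ox] oO].
  have xball : (ball x e)° !=set0.
    by exists x; exact: nbhsx_ballx.
  have [y [/interior_subset + Dy]] := dD _ xball (@open_interior _ _).
  by rewrite ballEmdist => xy; exists y.
have /metric_nbhsP[e e0 eO] : nbhs x O by exact: open_nbhs_nbhs.
by have [y Dy /eO Oy] := dD x e e0; exists y.
Qed.

Lemma dist_sup_lt (R : realType) (X : metricType R) n (x y : 'I_n -> X)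
    (eps : R) :
  0 < eps -> dist_sup x y < eps <-> forall i, mdist (x i) (y i) < eps.
Proof.
move=> eps0; split=> [/bigmax_ltP[_ xy] i|xy]; first exact: xy.
by apply/bigmax_ltP; split => // i _; exact: xy.
Qed.

Lemma exists_inv_nat_lt (R : realType) (e : R) : 0 < e ->
  exists n : nat, n.+1%:R^-1 < e.
Proof.
move=> e0; exists (Num.truncn e^-1).
by rewrite -ltf_pV2 ?posrE ?invr_gt0// invrK truncnS_gt.
Qed.

(** * Neighbourhoods of the identity and Roelcke precompactness *)

Section topological_group.
Context {G : topologicalGroupType}.
Implicit Types (V : set G) (a b g : G).

Lemma mulg2_continuous a b : continuous (fun x : G => (a * x * b)%g).
Proof.
have mulgD (f h : G -> G) : continuous f -> continuous h ->
    continuous (fun x => (f x * h x)%g).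
  move=> cf ch x.
  apply: (@continuous2_cvg _ _ _ _ _ _ f h (fun u v => u * v)%g (f x) (h x)).
  - exact: (@mulg_continuous G (f x, h x)).
  - exact: cf.
  - exact: ch.
apply: (mulgD (fun x => (a * x)%g) (fun=> b)); last exact: cst_continuous.
apply: (mulgD (fun=> a) id); first exact: cst_continuous.
by move=> x; exact: cvg_id.
Qed.

Lemma nbhs_conjg V a : nbhs 1%g V -> nbhs 1%g [set u | V (a^-1 * u * a)%g].
Proof.
move=> V1; apply: mulg2_continuous.
by rewrite mulg1 mulVg.
Qed.

Lemma nbhs_invg V : nbhs 1%g V -> nbhs 1%g [set u | V (u^-1)%g].
Proof. by move=> V1; apply: invg_continuous; rewrite /= invg1. Qed.

Lemma nbhs_mulg_split V : nbhs 1%g V ->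
  exists2 W, nbhs 1%g W & forall x y, W x -> W y -> V (x * y)%g.
Proof.
move=> V1; have : nbhs (1 * 1)%g V by rewrite mulg1.
move=> /(@mulg_continuous G (1%g, 1%g))[[A B] /= [A1 B1] ABV].
exists (A `&` B); first exact: filterI.
by move=> x y [Ax _] [_ By]; exact: (ABV (x, y)).
Qed.

Lemma nbhs_translate V a : nbhs a V <-> nbhs 1%g [set u | V (a * u)%g].
Proof.
split=> [aV|V1].
  have : nbhs 1%g ((fun u => a * u * 1)%g @^-1` V).
    by apply: mulg2_continuous; rewrite !mulg1.
  by apply: filterS => u /=; rewrite mulg1.
have : nbhs a ((fun u => a^-1 * u * 1)%g @^-1` [set u | V (a * u)%g]).
  by apply: mulg2_continuous; rewrite mulg1 mulVg.
by apply: filterS => u /=; rewrite mulg1 mulVKg.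
Qed.

Lemma roelcke_precompact_nbhs V : roelcke_precompact G -> nbhs 1%g V ->
  exists2 F : set G, finite_set F &
    forall g, exists v f w, [/\ V v, F f, V w & g = (v * f * w)%g].
Proof.
move=> rpG V1.
have [F finF /seteqP[+ _]] :=
  rpG V° (open_interior V) (nbhs_singleton (nbhs_interior V1)).
move=> FV; exists F => // g.
have [//|_ [v Vv [f Ff <-]] [w Vw <-]] := FV g.
by exists v, f, w; split => //; exact: interior_subset.
Qed.

(** By induction on n.  The correcting element u must be so small that f^-1 u f
    stays in W for each of the finitely many f already chosen; whence the
    neighbourhood W' below. *)
Lemma roelcke_precompact_power n V : roelcke_precompact G -> nbhs 1%g V ->
  exists2 F : set G, finite_set F & forall x : 'I_n -> G,
    exists2 v, V v & forall i, exists2 f, F f &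
      exists2 w, V w & x i = (v * (f * w))%g.
Proof.
move=> rpG; elim: n V => [|n IHn] V V1.
  exists set0 => // x; exists 1%g; first exact: nbhs_singleton.
  by case.
have [W W1 WV] := nbhs_mulg_split V1.
have sWV : W `<=` V.
  by move=> x Wx; rewrite -[x]mulg1; apply: WV => //; exact: nbhs_singleton.
have [F finF FW] := IHn W W1.
(* The inverse is there because u^-1 f w = f (f^-1 u f)^-1 w. *)
pose W' := W `&` \bigcap_(f in F) [set u | W ((f^-1 * u * f)^-1)%g].
have W'1 : nbhs 1%g W'.
  apply: filterI => //; apply: filter_finite_set => // f _.
  by apply: (@nbhs_conjg [set u | W (u^-1)%g]); exact: nbhs_invg.
have [E finE EW'] := roelcke_precompact_nbhs rpG W'1.
exists (F `|` E); first by rewrite finite_setU.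
move=> x; have [v Wv vx] := FW (x \o lift ord0).
have [u [e [w [[Wu uF] Ee [Ww _] xe]]]] := EW' (v^-1 * x ord0)%g.
exists (v * u)%g; first exact: WV.
move=> i; have [j ->|->] := unliftP ord0 i.
  have [f Ff [t Wt xj]] := vx j.
  exists f; [by left|exists ((f^-1 * u * f)^-1 * t)%g].
    by apply: WV => //; exact: uF.
  by rewrite -[x _]/((x \o lift ord0) j) xj !invgM invgK !mulgA !mulgK.
exists e; [by right|exists w; first exact: sWV].
by rewrite -[LHS](mulVKg v) xe !mulgA.
Qed.

End topological_group.

(** * Isometric actions with a dense orbit *)

(** Write x0 for a point with dense orbit, and approximate the i-th point by
    g_i x0.  If g_i = v f_i w_i, then v f_i x0 is as close to g_i x0 as x0 is
    to w_i x0, by invariance of the metric. *)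
Lemma power_cover_dense_translates (R : realType) (G : topologicalGroupType)
    (X : metricType R) (act : G -> X -> X) n (U : set G) (eps : R) :
  (forall V : set G, open V -> V 1%g ->
     exists2 F : set G, finite_set F &
       setT = diag_translate (fun v x : G => (v * x)%g) V
                [set x : 'I_n -> G | forall i, mulset F V (x i)]) ->
  continuous_isometric_action act -> dense_orbit act ->
  open U -> U 1%g -> 0 < eps ->
  exists2 A : set ('I_n -> X), finite_set A &
    sup_dense eps (diag_translate act U A).
Proof.
move=> cover [[act1 actM] isom_act cact] [x0 /dense_metricP dx0] oU U1 eps0.
have eps20 : 0 < eps / 2 by rewrite divr_gt0.
have [V [oV V1 VU Vx0]] : exists V : set G, [/\ open V, V 1%g, V `<=` U &
    forall v, V v -> mdist x0 (act v x0) < eps / 2].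
  have : nbhs (act 1%g x0) (ball x0 (eps / 2)).
    by rewrite act1; exact: nbhsx_ballx.
  move=> /(cact (1%g, x0))[[A B] /= [A1 Bx0] AB].
  exists ((A `&` U)°); split; first exact: open_interior.
  - by apply: filterI => //; exact: open_nbhs_nbhs.
  - by move=> g /interior_subset[].
  - move=> v /interior_subset[Av _]; have := AB (v, x0).
    rewrite /= ballEmdist; apply; split => //=; exact: nbhs_singleton.
have [F finF /seteqP[+ _]] := cover V oV V1; move=> FV.
exists [set (fun i => act (f i) x0) |
  f in [set f : 'I_n -> G | forall i, F (f i)]].
  exact/finite_image/finite_set_family.
move=> x.
have /choice[g gx] i : exists g, mdist (x i) (act g x0) < eps / 2.
  by have [_ [g _ <-] xg] := dx0 (x i) _ eps20; exists g.
have [//|v Vv [y yFV vyg]] := FV g.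
have /choice[f fP] i : exists f, F f /\ exists2 w, V w & (f * w)%g = y i.
  by have [f Ff [w Vw fw]] := yFV i; exists f; split => //; exists w.
exists (fun i => act v (act (f i) x0)).
  exists v; first exact: VU.
  exists (fun i => act (f i) x0) => //.
  by exists f => // i; have [] := fP i.
apply/dist_sup_lt => // i; have [_ [w Vw fw]] := fP i.
have gE : g i = (v * (f i * w))%g by rewrite fw -vyg.
rewrite [eps]splitr (le_lt_trans (metric_triangle _ (act (g i) x0) _))// ltrD//.
by rewrite gE !actM !isom_act metric_sym; exact: Vx0.
Qed.

(** * Approximately oligomorphic groups of isometries *)

(** The topology of pointwise convergence: the finite sets of points are
    represented by sequences because these concatenate, which makes the basic
    neighbourhoods a filter base. *)
Lemma isom_nbhsP (R : realType) (X : metricType R) (f : isom X)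
    (A : set (isom X)) :
  nbhs f A <-> exists s : seq X, exists2 e : R, 0 < e &
    forall g : isom X,
      (forall x, x \in s -> mdist (f x) (g x) < e) -> A g.
Proof.
split=> [[_ [[B oB <-] Bf BA]]|[s [e e0 sA]]].
  pose F : set_system {ptws X -> X} := fun C => exists s : seq X,
    exists2 e : R, 0 < e & forall g : X -> X,
      (forall x, x \in s -> mdist (f x) (g x) < e) -> C g.
  have FF : Filter F.
    split.
    - by exists [::], 1.
    - move=> C D [s [e e0 sC]] [t [d d0 tD]].
      exists (s ++ t), (Num.min e d); first by rewrite lt_min e0.
      move=> g fg; split; [apply: sC|apply: tD] => x xs.
        have := fg x; rewrite mem_cat xs lt_min => /(_ isT)/andP[//].
      have := fg x; rewrite mem_cat xs orbT lt_min => /(_ isT)/andP[//].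
    - by move=> C D CD [s [e e0 sC]]; exists s, e => // g /sC/CD.
  have Ff : F --> (isom_fun f : {ptws X -> X}).
    apply/cvg_sup => x.
    move=> C [_ [[D oD <-] Dfx DC]].
    have /metric_nbhsP[e e0 eD] : nbhs (f x) D by exact: open_nbhs_nbhs.
    exists [:: x], e => // g fg; apply: DC; apply: eD; apply: fg.
    by rewrite mem_head.
  have [s [e e0 sB]] := Ff B (open_nbhs_nbhs (conj oB Bf)).
  by exists s, e => // g fg; apply: BA; exact: sB.
have eval_nbhs x : nbhs f [set g : isom X | mdist (f x) (g x) < e].
  have : nbhs (f x) (ball (f x) e) by exact: nbhsx_ballx.
  move=> /(@proj_continuous X (fun=> X) x (isom_fun f)).
  move=> /(@initial_continuous (isom X) {ptws X -> X} (@isom_fun R X) f).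
  by rewrite ballEmdist.
have : nbhs f [set g : isom X | forall x, x \in s -> mdist (f x) (g x) < e].
  elim: s {sA} => [|x s IHs]; first exact: filterS filterT.
  apply: filterS2 (eval_nbhs x) IHs => g gx gs y.
  by rewrite inE => /predU1P[->|/gs].
by apply: filterS => g; exact: sA.
Qed.

(** Two elements f and g for which (x, f x) and (x, g x) are both close to
    translates h' a and h a of the same tuple a are related by g = v f w with
    v = h h'^-1: this v hardly moves x, and takes f x close to g x.  One
    representative f for each a in a finite set therefore suffices. *)
Lemma approx_oligomorphic_roelcke_precompact (R : realType)
    (G : topologicalGroupType) (X : metricType R) (act : G -> X -> X) (x0 : X) :
  group_action act -> (forall g, Defs.isometry (act g)) ->
  (forall V, nbhs 1%g V -> exists s : seq X, exists2 e : R, 0 < e &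
     forall g, (forall x, x \in s -> mdist x (act g x) < e) -> V g) ->
  approx_oligomorphic act -> roelcke_precompact G.
Proof.
move=> [act1 actM] isom_act act_nbhs olig V oV V1.
have [s [e e0 sV]] := act_nbhs V (open_nbhs_nbhs (conj oV V1)).
have e20 : 0 < e / 2 by rewrite divr_gt0.
(* The point x0 makes the tuple nonempty even when s is empty. *)
pose t := in_tuple (x0 :: s).
pose n := size (x0 :: s).
pose pairing g (k : 'I_(n + n)) :=
  match fintype.split k with inl i => tnth t i | inr i => act g (tnth t i) end.
have [A finA Adense] := olig (n + n)%N (e / 2) isT e20.
pose close (a : 'I_(n + n) -> X) g :=
  exists h, forall k, mdist (pairing g k) (act h (a k)) < e / 2.
(* rep a is one group element whose pair is close to a translate of a,
   whenever there is such an element. *)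
have /choice[rep repP] a : exists f, forall g, close a g -> close a f.
  have [[f af]|nclose] := pselect (exists g, close a g); first by exists f.
  by exists 1%g => g ag; exfalso; apply: nclose; exists g.
exists (rep @` A); first exact: finite_image.
apply/seteqP; split => // g _.
have [_ [h _ [a Aa <-]] /(dist_sup_lt _ _ e20) gh] := Adense (pairing g).
have [h' fh'] : close a (rep a) by apply: repP; exists h.
set f := rep a in fh'.
have moved k :
    mdist (act (h * h'^-1)%g (pairing f k)) (pairing g k) < e.
  rewrite [e]splitr (le_lt_trans (metric_triangle _ (act h (a k)) _))// ltrD//.
    by have := fh' k;
      rewrite -(isom_act (h * h'^-1)%g) -actM -mulgA mulVg mulg1.
  by rewrite metric_sym.
pose v := (h * h'^-1)%g; pose w := ((v * f)^-1 * g)%g.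
have Vv : V v.
  apply: sV => x xs.
  have xt : x \in t by rewrite inE xs orbT.
  have /tnthP[i ->] := xt.
  by have := moved (unsplit (inl i)); rewrite /pairing unsplitK metric_sym.
have Vw : V w.
  apply: sV => x xs.
  have xt : x \in t by rewrite inE xs orbT.
  have /tnthP[i ->] := xt.
  have := moved (unsplit (inr i)); rewrite /pairing unsplitK -actM.
  by rewrite -[X in _ -> is_true (X < _)](isom_act (v * f)%g) -actM mulVKg.
exists (v * f)%g; last by exists w => //; rewrite mulVKg.
by exists v => //; exists f => //; exists a.
Qed.

Lemma subgroup_roelcke_precompact (R : realType) (G : topologicalGroupType)
    (X : metricType R) (H : set (isom X)) (x0 : X) :
  topologically_isomorphic_to_subgroup G H ->
  approx_oligomorphic (fun (h : H) (x : X) => set_val h x) ->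
  roelcke_precompact G.
Proof.
move=> [phi [[_ [psi [cpsi phiK psiK]]] phiM]] olig.
have phi1 : set_val (phi 1%g) = 1%g.
  by apply: (@mulgI _ (set_val (phi 1%g))); rewrite -phiM !mulg1.
apply: (@approx_oligomorphic_roelcke_precompact R G X
  (fun g x => set_val (phi g) x) x0).
- split=> [x|g h x]; first by rewrite phi1.
  by rewrite phiM.
- by move=> g; exact: isom_isometry.
- move=> V V1.
  have : nbhs (phi 1%g) (psi @^-1` V) by apply: cpsi; rewrite phiK.
  move=> [_ [[B oB <-] /= B1 BV]].
  have /isom_nbhsP[s [e e0 sB]] : nbhs (set_val (phi 1%g)) B.
    exact: open_nbhs_nbhs.
  exists s, e => // g sg; rewrite -(phiK g); apply: BV; apply: sB => x xs.
  by rewrite phi1; exact: sg.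
- move=> n e n1 e0; have [A finA Adense] := olig n e n1 e0.
  exists A => // x; have [_ [h _ [a Aa <-]] xa] := Adense x.
  exists (fun i => set_val h (a i)) => //.
  by exists (psi h) => //; exists a => //; rewrite psiK.
Qed.

(** * Left invariant metrics *)

(** A copy of G carrying the left uniformity, generated by the sets of pairs
    (x, y) with x^-1 y in V, which is invariant under left translations. *)
Definition left_uniform (G : topologicalGroupType) : Type := G.

Section left_uniformity.
Local Open Scope relation_scope.
Context {G : topologicalGroupType}.

Definition left_entourage : set_system (left_uniform G * left_uniform G) :=
  filter_from (nbhs (1%g : G))
    (fun V => [set p | V ((p.1 : G)^-1 * (p.2 : G))%g]).

Let left_entourage_filter : Filter left_entourage.
Proof.
apply: filter_from_filter; first by exists setT; exact: filterT.
by move=> V W V1 W1; exists (V `&` W); first exact: filterI.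
Qed.

Let left_entourage_diagonal A : left_entourage A -> diagonal `<=` A.
Proof.
move=> [V V1 VA] [x y] /diagonalP ->; apply: VA => /=.
by rewrite mulVg; exact: nbhs_singleton.
Qed.

Let left_entourage_inv A : left_entourage A -> left_entourage A^-1.
Proof.
move=> [V V1 VA]; exists [set u | V (u^-1)%g]; first exact: nbhs_invg.
by move=> [x y] /= Vxy; apply: VA; rewrite /= -[x in X in V X]invgK -invgM.
Qed.

Let left_entourage_split A :
  left_entourage A -> exists2 B, left_entourage B & B \; B `<=` A.
Proof.
move=> [V V1 VA]; have [W W1 WV] := nbhs_mulg_split V1.
exists [set p | W ((p.1 : G)^-1 * (p.2 : G))%g]; first by exists W.
move=> [x y] [z /= Wxz Wzy]; apply: VA => /=.
by have := WV _ _ Wxz Wzy; rewrite -mulgA mulVKg.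
Qed.

HB.instance Definition _ := Choice.on (left_uniform G).
HB.instance Definition _ := isUniform.Build (left_uniform G)
  left_entourage_filter left_entourage_diagonal left_entourage_inv
  left_entourage_split.

End left_uniformity.

(** A left invariant metric compatible with the topology of G; by invariance,
    compatibility needs to be stated at 1 only. *)
Record left_metric (R : realType) (G : topologicalGroupType) := LeftMetric {
  ldist :> G -> G -> R ;
  ldistxx : forall x, ldist x x = 0 ;
  ldist_eq0 : forall x y, ldist x y = 0 -> x = y ;
  ldist_sym : forall x y, ldist x y = ldist y x ;
  ldist_triangle : forall y x z, ldist x z <= ldist x y + ldist y z ;
  ldistM : forall g x y, ldist (g * x)%g (g * y)%g = ldist x y ;
  nbhs_ldistP : forall V : set G, nbhs 1%g V <->
    exists2 e : R, 0 < e & forall x, ldist 1%g x < e -> V x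
}.

(** A uniformity with a countable base comes from a pseudometric, and the left
    uniformity has one as soon as 1 has a countable base of neighbourhoods.
    Taking the supremum of this pseudometric over all left translates makes it
    invariant, and does not change the uniformity because the entourages of
    the left uniformity are invariant already.  The supremum is written as the
    infimum of the radii that work for every translate. *)
Lemma birkhoff_kakutani (R : realType) (G : topologicalGroupType)
    (B : nat -> set G) :
  (forall n, nbhs 1%g (B n)) ->
  (forall V, nbhs 1%g V -> exists n, B n `<=` V) ->
  \bigcap_n B n `<=` [set 1%g] ->
  inhabited (left_metric R G).
Proof.
move=> B1 Bbase Bsep.
have cnt : countable_uniformity (left_uniform G).
  apply/countable_uniformityP.
  exists (fun n => [set p | B n ((p.1 : G)^-1 * (p.2 : G))%g]); last first.
    by move=> n; exists (B n).
  move=> A [V V1 VA]; have [n BV] := Bbase V V1.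
  by exists n => p /BV/VA.
pose U : pseudoMetricType R := countable_uniform cnt.
have entE : @left_entourage G = entourage_ (@ball R U).
  by rewrite entourage_ballE.
pose S (x y : G) := [set e : R | 0 < e /\
  forall g : G, ball ((g * x)%g : U) e ((g * y)%g : U)].
pose d x y := inf (S x y).
(* The pseudometric is bounded by 2, so that the infima exist. *)
have S0 x y : S x y !=set0.
  exists 2; split => // g.
  exact: countable_uniform.countable_uniform_bounded.
have lbS x y : lbound (S x y) 0 by move=> e [/ltW].
have d_ge0 x y : 0 <= d x y by exact: lb_le_inf.
have ball_d x y e : 0 < e ->
    (forall g : G, ball ((g * x)%g : U) e ((g * y)%g : U)) -> d x y <= e.
  by move=> e0 xy; apply: ge_inf; [exists 0|split].
have d_ball x y e : d x y < e ->
    forall g : G, ball ((g * x)%g : U) e ((g * y)%g : U).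
  move=> dxy g; have [r [r0 xyr] re] := inf_lt (S0 x y) dxy.
  exact: (@le_ball _ U _ r e (ltW re)).
have dxx x : d x x = 0.
  apply/eqP; rewrite eq_le d_ge0 andbT; apply/ler_addgt0Pl => e e0.
  by rewrite addr0; apply: ball_d => // g; exact: ballxx.
have d_sym x y : d x y = d y x.
  rewrite /d; congr inf; apply/seteqP.
  by split=> e [e0 xy]; split => // g; exact/ball_sym.
have d_triangle y x z : d x z <= d x y + d y z.
  apply/ler_addgt0Pr => e e0; rewrite [e]splitr addrACA.
  have lt_half (a b : G) : d a b < d a b + e / 2 by rewrite ltrDl divr_gt0.
  apply: ball_d => [|g]; first by rewrite addr_gt0// ltr_wpDl// divr_gt0.
  by apply: (@ball_triangle _ U (g * y)%g); exact: d_ball.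
have dM g x y : d (g * x)%g (g * y)%g = d x y.
  rewrite /d; congr inf; apply/seteqP; split=> e [e0 xy]; split => // h.
    by have := xy (h * g^-1)%g; rewrite !mulgA !mulgVK.
  by have := xy (h * g)%g; rewrite -!mulgA.
have d_nbhs V : nbhs 1%g V <->
    exists2 e : R, 0 < e & forall x, d 1%g x < e -> V x.
  split=> [V1|[e e0 eV]].
    have : left_entourage [set p : left_uniform G * left_uniform G |
        V ((p.1 : G)^-1 * (p.2 : G))%g] by exists V.
    rewrite entE => -[e /= e0 eV]; exists e => // x /d_ball/(_ 1%g).
    by rewrite !mul1g => /(eV (1%g, x)) /=; rewrite invg1 mul1g.
  have e20 : 0 < e / 2 by rewrite divr_gt0.
  have : entourage_ (@ball R U) [set p | ball p.1 (e / 2) p.2].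
    by exists (e / 2).
  rewrite -entE => -[W W1 Wball]; apply: filterS W1 => x Wx; apply: eV.
  rewrite (@le_lt_trans _ _ (e / 2)) ?ltr_pdivrMr ?ltr_pMr ?ltr1n//.
  apply: ball_d => // g.
  by apply: (Wball ((g * 1)%g, (g * x)%g)); rewrite /= mulg1 mulKg.
have d_eq0 x y : d x y = 0 -> x = y.
  move=> dxy; apply: (@mulgI _ (x^-1)%g); rewrite mulVg; apply/esym/Bsep => n _.
  have /d_nbhs[e e0] := B1 n; apply.
  by rewrite -(mulVg x) dM dxy.
by constructor; exact: (LeftMetric dxx d_eq0 d_sym d_triangle dM d_nbhs).
Qed.

(** * Completion of a metric space *)

(** The completion of a metric space, after Kuratowski: a point x is identified
    with the function d(x, .), and the completion is the closure of these
    functions under uniform convergence.  A bijective isometry g then acts on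
    the completion by composition with g^-1, without any extension argument. *)
Record completion (R : realType) (T : metricType R) := Completion {
  completion_fun :> T -> R ;
  completion_approx : forall e : R, 0 < e ->
    exists x, forall z, `|completion_fun z - mdist x z| <= e
}.

Section completion.
Import numFieldNormedType.Exports.
Context {R : realType} {T : metricType R}.
Implicit Types (c : completion T) (x y z : T).

HB.instance Definition _ := gen_eqMixin (completion T).
HB.instance Definition _ := gen_choiceMixin (completion T).

Let cdist c c' : R := sup [set `|c z - c' z| | z in setT].

Let dist_evalB x y z : `|mdist x z - mdist y z| <= mdist x y.
Proof.
rewrite ler_norml lerBlDr metric_triangle andbT lerBrDr addrC lerBlDr.
by rewrite addrC (metric_sym x y) metric_triangle.
Qed.

Let cdist_has_sup c c' : has_sup [set `|c z - c' z| | z in setT].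
Proof.
have [x cx] := completion_approx c ltr01.
have [y cy] := completion_approx c' ltr01.
split; first by exists `|c x - c' x|, x.
exists (1 + mdist x y + 1) => _ [z _ <-].
rewrite (le_trans (ler_distD (mdist y z) _ _))// lerD//; last by rewrite distrC.
by rewrite (le_trans (ler_distD (mdist x z) _ _))// lerD.
Qed.

Let cdist_ub c c' z : `|c z - c' z| <= cdist c c'.
Proof. by apply: sup_upper_bound; [exact: cdist_has_sup|exists z]. Qed.

Let cdist_le c c' e : (forall z, `|c z - c' z| <= e) -> cdist c c' <= e.
Proof.
move=> ce; apply: ge_sup; first by have [] := cdist_has_sup c c'.
by move=> _ [z _ <-].
Qed.

Let cdistxx c : cdist c c = 0.
Proof.
apply/eqP; rewrite eq_le cdist_le/=; last by move=> z; rewrite subrr normr0.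
have [z _] := completion_approx c ltr01.
by rewrite (le_trans (normr_ge0 _) (cdist_ub c c z)).
Qed.

Let cdist_positivity c c' : cdist c c' = 0 -> c = c'.
Proof.
move=> cc'0; have : completion_fun c = completion_fun c'.
  apply/funext => z; apply/eqP; rewrite -subr_eq0 -normr_le0 -cc'0.
  exact: cdist_ub.
case: c {cc'0} => c cP; case: c' => c' c'P /= cc'; subst c'.
by congr Completion; exact: Prop_irrelevance.
Qed.

Let cdist_sym c c' : cdist c c' = cdist c' c.
Proof.
by apply/eqP; rewrite eq_le; apply/andP; split; apply: cdist_le => z;
  rewrite distrC; exact: cdist_ub.
Qed.

Let cdist_triangle c' c c'' : cdist c c'' <= cdist c c' + cdist c' c''.
Proof.
apply: cdist_le => z; rewrite (le_trans (ler_distD (c' z) _ _))//.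
by rewrite lerD// cdist_ub.
Qed.

HB.instance Definition _ := isMetric.Build R (completion T)
  cdistxx cdist_positivity cdist_sym cdist_triangle.

Lemma mdist_completion_le c c' e :
  mdist c c' <= e <-> forall z, `|c z - c' z| <= e.
Proof.
split=> [ce z|]; last exact: cdist_le.
exact: le_trans (cdist_ub c c' z) ce.
Qed.

Lemma completion_ext c c' : (forall z, c z = c' z) -> c = c'.
Proof.
move=> cc'; apply: mdist_le0_eq.
by apply/mdist_completion_le => z; rewrite cc' subrr normr0.
Qed.

Lemma completion_inj_approx_self x (e : R) :
  0 < e -> exists y, forall z, `|mdist x z - mdist y z| <= e.
Proof. by move=> e0; exists x => z; rewrite subrr normr0 ltW. Qed.

Definition completion_inj x : completion T :=
  Completion (completion_inj_approx_self x).

Lemma mdist_completion_inj x y :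
  mdist (completion_inj x) (completion_inj y) = mdist x y.
Proof.
apply/eqP; rewrite eq_le; apply/andP; split.
  by apply/mdist_completion_le => z; exact: dist_evalB.
have /mdist_completion_le/(_ y) :=
  lexx (mdist (completion_inj x) (completion_inj y)).
by rewrite /= mdistxx subr0 ger0_norm// mdist_ge0.
Qed.

Lemma completion_inj_approx c (e : R) :
  0 < e -> exists x, mdist c (completion_inj x) < e.
Proof.
move=> e0; have e20 : 0 < e / 2 by rewrite divr_gt0.
have [x cx] := completion_approx c e20; exists x.
rewrite (@le_lt_trans _ _ (e / 2)) ?ltr_pdivrMr ?ltr_pMr ?ltr1n//.
exact/mdist_completion_le.
Qed.

(** A Cauchy filter of functions converges pointwise, and the limit is uniform
    because the oscillation on a member of the filter is bounded uniformly. *)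
Lemma complete_completion : complete_space (completion T).
Proof.
move=> F PF; rewrite /cauchy -entourage_ballE => cF.
have small (e : R) : 0 < e -> exists2 A, F A &
    forall c c', A c -> A c' -> forall z, `|c z - c' z| <= e.
  move=> e0.
  have /cF[[A B] /= [FA FB] AB] : entourage_ (@ball R (completion T))
      [set p : completion T * completion T | ball p.1 e p.2] by exists e.
  exists (A `&` B); first exact: filterI.
  move=> c c' [Ac _] [_ Bc']; apply/mdist_completion_le/ltW.
  by have := AB (c, c') (conj Ac Bc'); rewrite /= ballEmdist.
have ev_cvg z : cvg ((fun c : completion T => c z) @ F).
  apply: cauchy_cvg => U; rewrite -entourage_ballE => -[e /= e0 eU].
  have e20 : 0 < e / 2 by rewrite divr_gt0.
  have [A FA Ae] := small _ e20.
  pose S := [set (c : completion T) z | c in A].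
  have FS : F [set c : completion T | S (c z)].
    by apply: filterS FA => c Ac; exists c.
  exists (S, S); first by split.
  move=> [_ _] /= [[c Ac <-] [c' Ac' <-]]; apply: eU => /=.
  rewrite /ball/= (le_lt_trans (Ae _ _ Ac Ac' z))//.
  by rewrite ltr_pdivrMr ?ltr_pMr ?ltr1n.
pose l z : R := lim ((fun c : completion T => c z) @ F).
have l_near (e : R) A : F A ->
    (forall c c', A c -> A c' -> forall z, `|c z - c' z| <= e) ->
    forall c, A c -> forall z, `|c z - l z| <= e.
  move=> FA Ae c Ac z; apply/ler_addgt0Pr => r r0.
  have : F [set c' : completion T | `|l z - c' z| < r].
    by have /cvgrPdist_lt/(_ _ r0) := ev_cvg z.
  move=> /(filterI FA)/filter_ex[c' [Ac' lc']].
  rewrite (le_trans (ler_distD (c' z) _ _))// lerD//; first exact: Ae.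
  by rewrite distrC ltW.
have lP e : 0 < e -> exists x, forall z, `|l z - mdist x z| <= e.
  move=> e0; have e20 : 0 < e / 2 by rewrite divr_gt0.
  have [A FA Ae] := small _ e20.
  have [c Ac] := filter_ex FA.
  have [x cx] := completion_approx c e20.
  exists x => z; rewrite (le_trans (ler_distD (c z) _ _))// [e]splitr lerD//.
  by rewrite distrC; exact: l_near Ac _.
exists (Completion lP).
apply/metricType_numDomainType.fcvgrPdist_lt => e e0.
have e20 : 0 < e / 2 by rewrite divr_gt0.
have [A FA Ae] := small _ e20.
apply: (filterS _ FA) => c Ac; rewrite metric_sym.
rewrite (@le_lt_trans _ _ (e / 2)) ?ltr_pdivrMr ?ltr_pMr ?ltr1n//.
by apply/mdist_completion_le => z; exact: l_near Ac _.
Qed.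

End completion.

(** * Baire category in complete metric spaces *)

(** Nested closed balls whose radii tend to 0, the n-th step landing in O n.
    The strict and non-strict inequalities in step say that the closed ball
    chosen lies in the open ball it was chosen from. *)
Lemma baire_complete_metric (R : realType) (X : metricType R)
    (O : nat -> set X) :
  complete_space X -> (forall n, open (O n) /\ dense (O n)) ->
  dense (\bigcap_n O n).
Proof.
move=> cX odO; apply/dense_metricP => a d d0.
have step (n : nat) (p : X * {posnum R}) : exists q : X * {posnum R},
    q.2%:num <= n.+1%:R^-1 /\
    forall z, mdist q.1 z <= q.2%:num -> mdist p.1 z < p.2%:num /\ O n z.
  have [oO /dense_metricP dO] := odO n.
  have [y Oy xy] := dO p.1 p.2%:num [gt0 of p.2%:num].
  have /metric_nbhsP[e e0 eO] : nbhs y (O n) by exact: open_nbhs_nbhs.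
  have gap0 : 0 < p.2%:num - mdist p.1 y by rewrite subr_gt0.
  have s0 : 0 < Num.min n.+1%:R^-1 (Num.min e (p.2%:num - mdist p.1 y) / 2).
    by rewrite lt_min invr_gt0 ltr0n/= divr_gt0// lt_min e0.
  exists (y, PosNum s0) => /=; split=> [|z yz]; first by rewrite ge_min lexx.
  have : mdist y z < Num.min e (p.2%:num - mdist p.1 y).
    rewrite (le_lt_trans yz)// gt_min; apply/orP; right.
    by rewrite ltr_pdivrMr ?ltr_pMr ?ltr1n// lt_min e0.
  rewrite lt_min ltrBrDl => /andP[yze xyz]; split; last exact: eO.
  exact: le_lt_trans (metric_triangle _ y _) xyz.
have /choice[f fP] (np : nat * (X * {posnum R})) := step np.1 np.2.
(* Centre and radius of the n-th ball; the ball around u (n+1) lies in O n. *)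
pose fix u n := if n is k.+1 then f (k, u k) else (a, PosNum d0).
have u_small n : (u n.+1).2%:num <= n.+1%:R^-1 by have [] := fP (n, u n).
have u_step n z : mdist (u n.+1).1 z <= (u n.+1).2%:num ->
    mdist (u n).1 z < (u n).2%:num /\ O n z.
  by have [_] := fP (n, u n); apply.
have u_ball n k : mdist (u n).1 (u (n + k)%N).1 < (u n).2%:num.
  elim: k n => [|k IHk] n; first by rewrite addn0 mdistxx.
  by rewrite addnS -addSn; have [] := u_step n _ (ltW (IHk n.+1)).
have cu : cauchy ((fun n => (u n).1) @ \oo).
  move=> A; rewrite -entourage_ballE => -[e /= e0 eA].
  have e20 : 0 < e / 2 by rewrite divr_gt0.
  have [n ne] := exists_inv_nat_lt e20.
  pose B := [set x | mdist (u n.+1).1 x < e / 2].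
  have FB : \forall m \near \oo, B (u m).1.
    exists n.+1 => // m /= nm; rewrite /B/= -(subnKC nm).
    exact: (lt_trans (u_ball n.+1 _) (le_lt_trans (u_small n) ne)).
  exists (B, B); first by split.
  move=> [x y] [/= Bx By]; apply: eA; rewrite /= ballEmdist/= [e]splitr.
  rewrite (le_lt_trans (metric_triangle _ (u n.+1).1 _))// ltrD//.
  by rewrite metric_sym.
have [l ul] := cX _ _ cu.
have l_ball n : mdist (u n).1 l <= (u n).2%:num.
  apply/ler_addgt0Pr => r r0.
  have lr : nbhs l [set y | mdist l y < r] by apply/metric_nbhsP; exists r.
  have [N _ /(_ (n + N)%N (leq_addl _ _))/= lu] := ul _ lr.
  rewrite (le_trans (metric_triangle _ (u (n + N)%N).1 _))// lerD ?ltW//.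
  by rewrite metric_sym.
exists l; last by have [] := u_step 0%N l (l_ball 1%N).
by move=> n _; have [] := u_step n l (l_ball n.+1).
Qed.

Lemma homeomorphism_nbhsP (R : realType) (T : topologicalType)
    (M : metricType R) (f : T -> M) (t : T) (A : set T) :
  homeomorphism f -> nbhs t A <->
  exists2 e : R, 0 < e & forall s, mdist (f t) (f s) < e -> A s.
Proof.
move=> [cf [g [cg fK gK]]]; split=> [tA|[e e0 eA]].
  have : nbhs (f t) (g @^-1` A) by apply: cg; rewrite fK.
  by move=> /metric_nbhsP[e e0 eA]; exists e => // s /eA/=; rewrite fK.
have : nbhs t (f @^-1` (ball (f t) e)) by apply: cf; exact: nbhsx_ballx.
by rewrite ballEmdist; apply: filterS.
Qed.

(** A completely metrizable space embedded densely in a metric space is a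
    G_delta there.  O n consists of the points x near which the embedded copy
    of T is small, of diameter below 1/(n+1), for the complete metric of T; a
    point in all the O n thus traces a Cauchy filter on T, and is the image of
    its limit. *)
Lemma completely_metrizable_Gdelta (R : realType) (T : topologicalType)
    (X : metricType R) (i : T -> X) :
  completely_metrizable R T ->
  (forall t A, nbhs t A <->
     exists2 e : R, 0 < e & forall s, mdist (i t) (i s) < e -> A s) ->
  dense (range i) ->
  exists O : nat -> set X, (forall n, open (O n)) /\ \bigcap_n O n = range i.
Proof.
move=> [M [f [cM hf]]] i_nbhs /dense_metricP di.
pose small (x : X) (r e : R) := forall s t, mdist x (i s) < r ->
  mdist x (i t) < r -> mdist (f s) (f t) < e.
pose O n := [set x | exists2 r : R, 0 < r & small x r n.+1%:R^-1].
exists O; split=> [n|].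
  rewrite openE => x [r r0 xr]; apply/metric_nbhsP.
  exists (r / 2); first by rewrite divr_gt0.
  move=> y xy; exists (r / 2); first by rewrite divr_gt0.
  have near_x s : mdist y (i s) < r / 2 -> mdist x (i s) < r.
    move=> ys.
    by rewrite [r]splitr (le_lt_trans (metric_triangle _ y _))// ltrD.
  by move=> s t /near_x xs /near_x xt; exact: xr.
apply/seteqP; split=> [x Ox|_ [t _ <-] n _].
  (* The trace on T of the neighbourhoods of x, seen in M. *)
  pose F : set_system M := filter_from [set r : R | 0 < r]
    (fun r => [set f t | t in [set t | mdist x (i t) < r]]).
  have PF : ProperFilter F.
    apply: filter_from_proper => [|r r0].
      apply: filter_from_filter; first by exists 1 => /=.
      move=> r r' r0 r'0; exists (Num.min r r'); first by rewrite /= lt_min r0.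
      move=> _ [t /= xt <-]; move: xt; rewrite lt_min => /andP[xr xr'].
      by split; exists t.
    by have [_ [t _ <-] xt] := di x r r0; exists (f t); exists t.
  have cF : cauchy F.
    move=> A; rewrite -entourage_ballE => -[e /= e0 eA].
    have [n ne] := exists_inv_nat_lt e0.
    have [r r0 xr] := Ox n I.
    pose B := [set f t | t in [set t | mdist x (i t) < r]].
    have FB : F B by exists r.
    exists (B, B); first by split.
    move=> [_ _] [/= [s xs <-] [t xt <-]]; apply: eA.
    by rewrite /= ballEmdist; exact: lt_trans (xr _ _ xs xt) ne.
  have [l Fl] := cM _ PF cF.
  have [t ft] : exists t, f t = l.
    by have [_ [g [_ _ gK]]] := hf; exists (g l).
  exists t => //; apply: mdist_le0_eq; apply/ler_addgt0Pr => e e0.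
  rewrite add0r; have e20 : 0 < e / 2 by rewrite divr_gt0.
  have : nbhs t [set s | mdist (i t) (i s) < e / 2].
    by apply/i_nbhs; exists (e / 2).
  move=> /(homeomorphism_nbhsP _ _ hf)[d d0 dt].
  have [r /= r0 xr] : F (ball l d) by apply: Fl; exact: nbhsx_ballx.
  have m0 : 0 < Num.min r (e / 2) by rewrite lt_min r0.
  have [_ [s _ <-]] := di x _ m0; rewrite lt_min => /andP[xs xse].
  rewrite [e]splitr (le_trans (metric_triangle _ (i s) _))// lerD//.
    apply/ltW/dt; rewrite ft; have := xr (f s).
    by rewrite ballEmdist; apply; exists s.
  by rewrite metric_sym ltW.
have n20 : 0 < n.+1%:R^-1 / 2 :> R by rewrite divr_gt0// invr_gt0.
have : nbhs t [set s | mdist (f t) (f s) < n.+1%:R^-1 / 2].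
  by apply/(homeomorphism_nbhsP _ _ hf); exists (n.+1%:R^-1 / 2).
move=> /i_nbhs[r r0 rt]; exists r => // s s' /rt ts /rt ts'.
rewrite [ltRHS]splitr (le_lt_trans (metric_triangle _ (f t) _))// ltrD//.
by rewrite metric_sym.
Qed.

(** * The action of a group on its left completion *)

(** A copy of G whose topology is the one given by the metric d. *)
Definition left_metric_space (R : realType) (G : topologicalGroupType)
  (d : left_metric R G) : Type := G.

HB.instance Definition _ (R : realType) (G : topologicalGroupType)
  (d : left_metric R G) := Choice.on (left_metric_space d).
HB.instance Definition _ (R : realType) (G : topologicalGroupType)
    (d : left_metric R G) :=
  isMetric.Build R (left_metric_space d) (ldistxx d) (@ldist_eq0 _ _ d)
    (ldist_sym d) (ldist_triangle d).

Section left_completion.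
Context {R : realType} {G : topologicalGroupType} (d : left_metric R G).
Implicit Types (g h x : G).

Notation X := (completion (left_metric_space d)).

Definition left_inj : G -> X := @completion_inj R (left_metric_space d).

Lemma mdist_left_inj g h : mdist (left_inj g) (left_inj h) = d g h.
Proof. exact: mdist_completion_inj. Qed.

Lemma left_inj_approx (c : X) (e : R) :
  0 < e -> exists g, mdist c (left_inj g) < e.
Proof. exact: (@completion_inj_approx R (left_metric_space d)). Qed.

Lemma left_injI : injective left_inj.
Proof.
move=> g h gh; apply: (ldist_eq0 (l := d)).
by rewrite -mdist_left_inj gh mdistxx.
Qed.

Lemma nbhs_left_metric g (A : set G) : nbhs g A <->
  exists2 e : R, 0 < e & forall h, d g h < e -> A h.
Proof.
rewrite nbhs_translate (nbhs_ldistP d); split=> -[e e0 eA]; exists e => // h gh.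
  rewrite -(mulVKg g h); apply: eA.
  by rewrite -(ldistM d g) mulg1 mulVKg.
by apply: eA; rewrite -(ldistM d g^-1%g) mulVg mulKg.
Qed.

Lemma translate_subproof g (c : X) (e : R) : 0 < e ->
  exists x, forall z, `|c (g^-1 * z)%g - d x z| <= e.
Proof.
move=> e0; have [x cx] := completion_approx c e0.
by exists (g * x)%g => z; rewrite -(ldistM d (g^-1)%g) mulKg; exact: cx.
Qed.

Definition translate g (c : X) : X :=
  @Completion R (left_metric_space d) _ (translate_subproof g c).

Lemma group_action_translate : group_action translate.
Proof.
split=> [c|g h c]; apply: completion_ext => z /=; first by rewrite invg1 mul1g.
by rewrite invgM mulgA.
Qed.

Lemma translate_left_inj g x : translate g (left_inj x) = left_inj (g * x)%g.
Proof.
by apply: completion_ext => z /=; rewrite -[LHS](ldistM d g) mulVKg.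
Qed.

Lemma translate_isometry g : Defs.isometry (translate g).
Proof.
suff le_translate h c c' : mdist (translate h c) (translate h c') <= mdist c c'.
  have [t1 tM] := group_action_translate.
  move=> c c'; apply/eqP; rewrite eq_le le_translate/=.
  by have := le_translate (g^-1)%g (translate g c) (translate g c');
    rewrite -!tM mulVg !t1.
apply/mdist_completion_le => z /=.
by have /mdist_completion_le := lexx (mdist c c'); apply.
Qed.

(** On points of G this is the continuity of right multiplications; the other
    points are approximated by those, uniformly in h as the action is
    isometric. *)
Lemma nbhs_translate_orbit g (c : X) (e : R) : 0 < e ->
  nbhs g [set h | mdist (translate g c) (translate h c) < e].
Proof.
move=> e0; have e30 : 0 < e / 3 by rewrite divr_gt0.
have [x cx] := left_inj_approx c e30.
have : nbhs g ((fun h => 1 * h * x)%g @^-1` [set u | d (g * x)%g u < e / 3]).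
  apply: mulg2_continuous; rewrite mul1g; apply/nbhs_left_metric.
  by exists (e / 3).
apply: filterS => h /=; rewrite mul1g => gh.
have -> : e = e / 3 + (e / 3 + e / 3) by lra.
rewrite (le_lt_trans (metric_triangle _ (translate g (left_inj x)) _))//.
rewrite ltrD ?translate_isometry//.
rewrite (le_lt_trans (metric_triangle _ (translate h (left_inj x)) _))//.
rewrite ltrD ?translate_isometry//; last by rewrite metric_sym.
by rewrite !translate_left_inj mdist_left_inj.
Qed.

Lemma translate_continuous : continuous_isometric_action translate.
Proof.
split; [exact: group_action_translate|exact: translate_isometry|].
move=> [g c] /= A /metric_nbhsP[e e0 eA].
have e20 : 0 < e / 2 by rewrite divr_gt0.
exists ([set h | mdist (translate g c) (translate h c) < e / 2],
  ball c (e / 2)).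
  by split; [exact: nbhs_translate_orbit|exact: nbhsx_ballx].
move=> [h c'] /= [gh]; rewrite ballEmdist/= => cc'; apply: eA.
rewrite [e]splitr (le_lt_trans (metric_triangle _ (translate h c) _))// ltrD//.
by rewrite translate_isometry.
Qed.

Lemma dense_left_inj : dense (range left_inj).
Proof.
apply/dense_metricP => c e /(left_inj_approx c)[x cx].
by exists (left_inj x) => //; exists x.
Qed.

Lemma translate_dense_orbit : dense_orbit translate.
Proof.
exists (left_inj 1%g).
rewrite (_ : [set _ | _ in _] = range left_inj); first exact: dense_left_inj.
by apply/seteqP; split=> _ [g _ <-]; exists g => //;
  rewrite translate_left_inj mulg1.
Qed.

Lemma separable_left_completion : separable G -> separable X.
Proof.
move=> [D cD dD]; exists (left_inj @` D).
  exact: sub_countable (card_image_le _ _) cD.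
apply/dense_metricP => c e e0; have e20 : 0 < e / 2 by rewrite divr_gt0.
have [x cx] := left_inj_approx c e20.
have xe : nbhs x [set y | d x y < e / 2].
  by apply/nbhs_left_metric; exists (e / 2).
have [y [/interior_subset xy Dy]] :=
  dD _ (ex_intro _ x xe) (@open_interior _ [set y | d x y < e / 2]).
exists (left_inj y); first by exists y.
rewrite [e]splitr (le_lt_trans (metric_triangle _ (left_inj x) _))// ltrD//.
by rewrite mdist_left_inj.
Qed.

Lemma translate_surj g (c : X) : exists c', translate g c' = c.
Proof.
have [t1 tM] := group_action_translate.
by exists (translate g^-1%g c); rewrite -tM mulgV t1.
Qed.

Definition translation g : isom X :=
  Isom (translate_isometry g) (translate_surj g).

Lemma translationM g h :
  translation (g * h)%g = (translation g * translation h)%g.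
Proof. by apply: isomP => c /=; rewrite (group_action_translate.2 g h). Qed.

Lemma translation1 : translation 1%g = 1%g.
Proof. by apply: isomP => c /=; rewrite group_action_translate.1. Qed.

Lemma translation_inj : injective translation.
Proof.
move=> g h gh; apply: left_injI.
by have := congr1 (fun f : isom X => f (left_inj 1%g)) gh;
  rewrite /= !translate_left_inj !mulg1.
Qed.

Lemma group_closed_translations : group_closed [in range translation].
Proof.
split; first by apply/mem_set; exists 1%g => //; exact: translation1.
move=> f f' /set_mem[g _ <-] /set_mem[h _ <-]; apply/mem_set.
exists (g * h^-1)%g => //; rewrite translationM; congr (_ * _)%g.
by apply: (@mulgI _ (translation h)); rewrite -translationM !mulgV translation1.
Qed.

(** The value of a translation at 1 determines the group element, and with its
    topology: evaluation at 1 provides the continuous inverse. *)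
Lemma translations_homeomorphic :
  topologically_isomorphic_to_subgroup G (range translation).
Proof.
pose phi g : range translation :=
  exist _ (translation g) (mem_set (imageT translation g)).
have /choice[psi psiE] (f : range translation) :
    exists g, translation g = set_val f.
  by have [g _ gf] := set_mem (valP f); exists g.
exists phi; split; last by move=> x y; exact: translationM.
have phiK : cancel phi psi by move=> g; apply: translation_inj; rewrite psiE.
split; last exists psi; [|split=> //].
- move=> g A [_ [[B oB <-] Bg BA]].
  have /isom_nbhsP[s [e e0 sB]] : nbhs (translation g) B.
    exact: open_nbhs_nbhs.
  have : nbhs g (\bigcap_(c in [set` s])
      [set h | mdist (translate g c) (translate h c) < e]).
    apply: filter_finite_set; first by apply/finite_seqP; exists s.
    by move=> c _; exact: nbhs_translate_orbit.
  by apply: filterS => h gh; apply: BA; apply: sB => c cs; exact: gh.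
- move=> f A /nbhs_left_metric[e e0 eA].
  have f_nbhs : nbhs f ((set_val : range translation -> isom X) @^-1`
      [set f' : isom X |
        mdist (set_val f (left_inj 1%g)) (f' (left_inj 1%g)) < e]).
    apply: (@initial_continuous (range translation) (isom X) set_val).
    apply/isom_nbhsP; exists [:: left_inj 1%g], e => // f'; apply.
    by rewrite mem_head.
  suff : nbhs f (psi @^-1` A) by [].
  apply: filterS f_nbhs => f' /=.
  rewrite -!psiE /= !translate_left_inj !mulg1.
  by rewrite mdist_left_inj; exact: eA.
- by move=> f; apply: val_inj; rewrite /= psiE.
Qed.

(** Both G and its preimage under an isometry h of X are dense G_delta subsets
    of the complete space X, so they have a common point c: here c and h(c)
    come from elements a and b of G.  If h is a pointwise limit of
    translations by elements k, then k a tends to b in G, so that k tends to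
    b a^-1 and h is the translation by b a^-1. *)
Lemma closed_translations :
  completely_metrizable R G -> closed (range translation).
Proof.
move=> cmG h clh.
have left_inj_nbhs g A : nbhs g A <->
    exists2 e : R, 0 < e & forall x, mdist (left_inj g) (left_inj x) < e -> A x.
  rewrite nbhs_left_metric.
  by split=> -[e e0 eA]; exists e => // x; have := eA x; rewrite mdist_left_inj.
have [W [openW WE]] :=
  completely_metrizable_Gdelta cmG left_inj_nbhs dense_left_inj.
have dW n : dense (W n).
  move=> D D0 oD; have [x [Dx]] := dense_left_inj D0 oD.
  by rewrite -WE => /(_ n I) Wx; exists x.
pose W' n := W n `&` h @^-1` W n.
have odW' n : open (W' n) /\ dense (W' n).
  have ohW : open (h @^-1` W n).
    rewrite openE => c /= hcW.
    have /metric_nbhsP[e e0 eW] : nbhs (h c) (W n).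
      exact: (open_nbhs_nbhs (conj (openW n) hcW)).
    apply/metric_nbhsP; exists e => // c' cc'; apply: eW.
    by rewrite isom_isometry.
  split; first exact: openI.
  apply: denseI => //; apply/dense_metricP => c e e0.
  have /dense_metricP/(_ (h c) e e0)[c' Wc' hc'] := dW n.
  have [c'' hc''] := isom_surj h c'.
  exists c''; first by rewrite /= hc''.
  by rewrite -(isom_isometry h) hc''.
have /dense_metricP/(_ (left_inj 1%g) 1 ltr01)[c Wc _] :=
  baire_complete_metric (@complete_completion _ _) odW'.
have [a _ ca] : range left_inj c by rewrite -WE => n _; have [] := Wc n I.
have [b _ hcb] : range left_inj (h c).
  by rewrite -WE => n _; have [] := Wc n I.
exists (b * a^-1)%g => //; apply: isomP => z.
apply: mdist_le0_eq; apply/ler_addgt0Pr => e e0; rewrite add0r.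
have e20 : 0 < e / 2 by rewrite divr_gt0.
have : nbhs b ((fun u => 1 * u * a^-1)%g @^-1`
    [set u | mdist (translate (b * a^-1)%g z) (translate u z) < e / 2]).
  by apply: mulg2_continuous; rewrite mul1g; exact: nbhs_translate_orbit.
move=> /nbhs_left_metric[r r0 br].
have [_ [[k _ <-] /= kh]] : range translation `&` [set f : isom X |
    forall x : X, x \in ([:: c; z] : seq X) ->
      mdist (h x) (f x) < Num.min r (e / 2)] !=set0.
  apply: clh; apply/isom_nbhsP; exists [:: c; z], (Num.min r (e / 2)) => //.
  by rewrite lt_min r0.
have /andP[kc _] : (mdist (h c) (translate k c) < r) &&
    (mdist (h c) (translate k c) < e / 2) by rewrite -lt_min kh ?mem_head.
have /andP[_ kz] : (mdist (h z) (translate k z) < r) &&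
    (mdist (h z) (translate k z) < e / 2).
  by rewrite -lt_min kh ?inE ?eqxx ?orbT.
rewrite [e]splitr (le_trans (metric_triangle _ (translate k z) _))// lerD//.
  have := br (k * a)%g; rewrite /= mul1g mulgK => brk; apply/ltW/brk.
  by move: kc; rewrite -hcb -ca translate_left_inj mdist_left_inj.
by rewrite metric_sym ltW.
Qed.

End left_completion.

Lemma completely_metrizable_left_metric (R : realType)
    (G : topologicalGroupType) :
  completely_metrizable R G -> inhabited (left_metric R G).
Proof.
move=> [M [f [_ hf]]].
apply: (@birkhoff_kakutani R G
  (fun n => [set x | mdist (f 1%g) (f x) < n.+1%:R^-1])).
- by move=> n; apply/(homeomorphism_nbhsP _ _ hf); exists n.+1%:R^-1.
- move=> V /(homeomorphism_nbhsP _ _ hf)[e e0 eV].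
  have [n ne] := exists_inv_nat_lt e0.
  by exists n => x /= xn; apply: eV; exact: lt_trans ne.
- move=> x xB /=; have [_ [g [_ fK _]]] := hf; apply: (can_inj fK).
  apply: mdist_le0_eq; rewrite leNgt.
  apply/negP; rewrite metric_sym => /exists_inv_nat_lt[n].
  by rewrite ltNge => /negP; apply; exact/ltW/(xB n).
Qed.

Lemma polish_group_isom_subgroup (R : realType) (G : topologicalGroupType) :
  polish_group R G ->
  (forall (X : metricType R) (act : G -> X -> X),
     continuous_isometric_action act -> dense_orbit act ->
     approx_oligomorphic act) ->
  exists (X : metricType R) (H : set (isom X)),
    [/\ separable X,
        complete_space X,
        group_closed [in H] /\ closed H,
        topologically_isomorphic_to_subgroup G H
      & let act := fun (h : H) (x : X) => set_val h x in
        approx_oligomorphic act /\ dense_orbit act].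
Proof.
move=> [sG cmG] olig; have [d] := completely_metrizable_left_metric cmG.
exists (completion (left_metric_space d)), (range (@translation R G d)).
split.
- exact: separable_left_completion.
- exact: complete_completion.
- by split; [exact: group_closed_translations|exact: closed_translations].
- exact: translations_homeomorphic.
- pose phi g : range (@translation R G d) :=
    exist _ (translation d g) (mem_set (imageT (@translation R G d) g)).
  have oligG := olig _ _ (translate_continuous d) (translate_dense_orbit d).
  have [c dc] := translate_dense_orbit d.
  split=> [n e n1 e0|].
    have [A finA Adense] := oligG n e n1 e0; exists A => // x.
    have [_ [g _ [a Aa <-]] xa] := Adense x.
    exists (fun i => translate g (a i)) => //.
    by exists (phi g) => //; exists a.
  exists c; move: dc; congr dense; apply/seteqP.
  split=> [_ [g _ <-]|_ [h _ <-]].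
    by exists (phi g).
  have [g _ gh] := set_mem (valP h).
  by exists g => //=; rewrite set_valE /= -gh.
Qed.

(** * The equivalence *)

Theorem proposition1p20 (R : realType) (G : topologicalGroupType)
    (polishG : polish_group R G) :
  [<->
    roelcke_precompact G;
    forall (n : nat) (V : set G), (1 <= n)%N -> open V -> V 1%g ->
      exists2 F : set G, finite_set F &
        setT = diag_translate (fun v x : G => (v * x)%g) V
                 [set x : 'I_n -> G | forall i, mulset F V (x i)];
    forall (X : metricType R) (act : G -> X -> X),
      continuous_isometric_action act -> dense_orbit act ->
      forall (U : set G) (eps : R) (n : nat),
        open U -> U 1%g -> 0 < eps -> (1 <= n)%N ->
        exists2 A : set ('I_n -> X), finite_set A &
          sup_dense eps (diag_translate act U A);
    exists (X : metricType R) (H : set (isom X)),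
      [/\ separable X,
          complete_space X,
          group_closed [in H] /\ closed H,
          topologically_isomorphic_to_subgroup G H
        & let act := fun (h : H) (x : X) => set_val h x in
          approx_oligomorphic act /\ dense_orbit act] ].
Proof.
tfae.
- move=> rpG n V _ oV V1.
  have [F finF FV] :=
    roelcke_precompact_power n rpG (open_nbhs_nbhs (conj oV V1)).
  exists F => //; apply/seteqP; split => // x _; have [v Vv vx] := FV x.
  exists v => //; exists (fun i => v^-1 * x i)%g => /=.
    move=> i; have [f Ff [w Vw ->]] := vx i.
    by rewrite mulKg; exists f => //; exists w.
  by apply/funext => i; rewrite mulVKg.
- move=> cover X act cact dact U eps n oU U1 eps0 n1.
  by apply: power_cover_dense_translates => // V; exact: cover.
- move=> dense_translates; apply: polish_group_isom_subgroup => //.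
  move=> X act cact dact n eps n1 eps0.
  by apply: dense_translates => //; exact: openT.
- move=> [X [H [_ _ _ GH [olig [x0 _]]]]].
  exact: subgroup_roelcke_precompact x0 GH olig.
Qed.
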